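(* Let $u$ be a positive integer with $u \equiv 1$ or $4 \pmod{12}$. Then there exists a Kirkman triple system of order $32u+1$ with chromatic number $4$, which furthermore admits an equitable $4$-colouring.
   Context: A Kirkman triple system KTS$(n)$ is a Steiner triple system on $n$ points together with a partition of its triples into parallel classes. A $\delta$-colouring maps points to $\delta$ colours with no monochromatic triple; the chromatic number is the least such $\delta$. A colouring is equitable if its colour class sizes differ pairwise by at most one. *)

(* Defs.v *)
From mathcomp Require Import all_boot.

Set Implicit Arguments.
Unset Strict Implicit.
Unset Printing Implicit Defensive.

Definition steiner_triple_system (T : finType) (B : {set {set T}}) : Prop :=
  (forall b : {set T}, b \in B -> #|b| = 3) /\
  (forall x y : T, x != y ->
     exists! b : {set T}, b \in B /\ (x \in b /\ y \in b)).

Definition parallel_class (T : finType) (B C : {set {set T}}) : Prop :=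
  C \subset B /\ partition C [set: T].

Definition kirkman_triple_system
    (T : finType) (B : {set {set T}}) (P : {set {set {set T}}}) : Prop :=
  [/\ steiner_triple_system B,
      partition P B
    & forall C : {set {set T}}, C \in P -> parallel_class B C].

Definition monochromatic (T : finType) (d : nat) (c : T -> 'I_d)
    (b : {set T}) : Prop :=
  exists i : 'I_d, forall x : T, x \in b -> c x = i.

Definition colouring (T : finType) (B : {set {set T}}) (d : nat)
    (c : T -> 'I_d) : Prop :=
  forall b : {set T}, b \in B -> ~ monochromatic c b.

Definition colourable (T : finType) (B : {set {set T}}) (d : nat) : Prop :=
  exists c : T -> 'I_d, colouring B c.

Definition chromatic_number_is (T : finType) (B : {set {set T}})
    (d : nat) : Prop :=
  colourable B d /\ (forall d' : nat, colourable B d' -> d <= d').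

Definition colour_class (T : finType) (d : nat) (c : T -> 'I_d)
    (i : 'I_d) : {set T} :=
  [set x | c x == i].

(* The bound is required for both orders of each pair of colours, so it
   bounds the absolute difference. *)
Definition equitable (T : finType) (d : nat) (c : T -> 'I_d) : Prop :=
  forall i j : 'I_d, #|colour_class c i| <= #|colour_class c j| + 1.

(* Main.v *)
Require Import Defs.
From mathcomp Require Import all_boot.
From mathcomp Require Import zify.

(** Start from a Steiner system S(2,4,u). Blow every point up to a group of 32
    points, put a Kirkman frame of type 32^4 on the four groups of each block, and
    a KTS(33) on each group together with one common point at infinity. A partial
    parallel class of the frames that misses a group is completed by a parallel
    class of the KTS(33) on that group, so the result is a KTS(32u+1). Both
    ingredients carry a 4-colouring with eight points of each colour in a group,
    the same one on every group, and the KTS(33) is not 3-colourable, which is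
    checked by an exhaustive search.

    The systems S(2,4,3r+1) with r = 0, 1 mod 4 are built by induction on r, writing
    r = 4m + t with 0 <= t <= m and using a transversal design TD(5,m) with one
    group truncated to t points; a few small systems come from difference
    families. *)

Set Implicit Arguments.
Unset Strict Implicit.
Unset Printing Implicit Defensive.

(** * Refutation of 3-colourings by backtracking *)

(* [nth n (nth [::] third x) y] is the third point of the triple through [x] and
   [y], or [n] if there is none; in a partial colouring [col] the value [3] marks
   an uncoloured point, and a cell pairs an uncoloured point with its remaining
   colours. *)
Section Refutation.

Variables (third : seq (seq nat)) (n : nat).

Definition cell := (nat * seq nat)%type.

Fixpoint tightest (best : cell) (us : seq cell) : cell :=
  if us is u :: us' then
    tightest (if size u.2 < size best.2 then u else best) us'
  else best.

Definition prune (col row : seq nat) (k : nat) (u : cell) : cell :=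
  if nth 3 col (nth n row u.1) == k then (u.1, [seq l <- u.2 | l != k]) else u.

Fixpoint refute (fuel : nat) (col : seq nat) (us : seq cell) : bool :=
  if fuel isn't f.+1 then false else
  if us isn't u :: us' then false else
  let b := tightest u us' in
  let row := nth [::] third b.1 in
  let rest := [seq w <- us | w.1 != b.1] in
  all (fun k => refute f (set_nth 3 col b.1 k) [seq prune col row k w | w <- rest])
      b.2.

Lemma mem_tightest best us : tightest best us \in best :: us.
Proof.
elim: us best => [|u us IH] best /=; first by rewrite mem_head.
have := IH (if size u.2 < size best.2 then u else best).
rewrite !inE; case: ifP => _ /orP[/eqP->|->]; by rewrite ?eqxx ?orbT.
Qed.

Variable c : nat -> nat.
Hypothesis c_lt3 : forall x, c x < 3.
Hypothesis c_third : forall x y,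
  let z := nth n (nth [::] third x) y in z < n -> c x = c y -> c x = c z -> False.

Lemma refute_sound fuel col us :
  size col <= n ->
  (forall x, x < size col -> nth 3 col x < 3 -> c x = nth 3 col x) ->
  all (fun u : cell => (u.1 < n) && (c u.1 \in u.2)) us ->
  ~~ refute fuel col us.
Proof.
elim: fuel col us => [|f IH] col [|u us] // col_n colP usP /=.
set b := tightest u us.
have /(allP usP) /andP[bn bP] : b \in u :: us by apply: mem_tightest.
apply/allPn; exists (c b.1) => //.
apply: IH.
- by rewrite size_set_nth geq_max bn.
- move=> x _; rewrite nth_set_nth /=; case: eqP => [->|_] // lt3.
  apply: colP => //; rewrite ltnNge; apply/negP => le.
  by rewrite nth_default in lt3.
have aux w : w \in u :: us ->
    let w' := prune col (nth [::] third b.1) (c b.1) w in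
    (w'.1 < n) && (c w'.1 \in w'.2).
  move=> /(allP usP) /andP[wn wP] /=; rewrite /prune.
  (* A colour is deleted only if it would complete a monochromatic triple with a third point [z]
     coloured earlier; uncoloured points read as 3, which [c] never takes. *)
  case: eqP => [E|_] /=; rewrite ?wn ?wP //= mem_filter wP andbT.
  set z := nth n _ _ in E.
  have zc : z < size col.
    by rewrite ltnNge; apply/negP => le; move: (c_lt3 b.1); rewrite -E nth_default.
  apply/eqP => E2.
  apply: (@c_third b.1 w.1) => //; first exact: leq_trans zc col_n.
  by rewrite -E; symmetry; apply: colP => //; rewrite E.
apply/allP => _ /mapP[w w_in ->]; apply: aux; move: w_in.
by rewrite -[X in w \in X]/([seq w <- u :: us | w.1 != b.1]) mem_filter => /andP[].
Qed.

End Refutation.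

(** * A Kirkman triple system of order 33 *)

(* Found by computer search among the systems obtained from the eight lines of
   AG(2,3) that miss the origin: every point is blown up to four points, every
   line becomes a resolvable transversal design, and every group together with
   the point 32 carries a copy of AG(2,3).  The points are labelled so that
   [x %/ 4 %% 4] is a 4-colouring with classes of sizes 9, 8, 8, 8. *)
Definition kts33_classes : seq (seq (seq nat)) :=
  [:: [:: [:: 0; 2; 29]; [:: 1; 13; 20]; [:: 3; 18; 28]; [:: 4; 14; 26]; [::
       5; 12; 22]; [:: 6; 19; 23]; [:: 7; 10; 32]; [:: 8; 15; 30]; [:: 9; 25;
       31]; [:: 11; 21; 24]; [:: 16; 17; 27]];
      [:: [:: 0; 16; 31]; [:: 1; 23; 30]; [:: 2; 18; 27]; [:: 3; 9; 17]; [::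
       4; 15; 20]; [:: 5; 10; 21]; [:: 6; 13; 14]; [:: 7; 11; 22]; [:: 8; 19;
       26]; [:: 12; 24; 32]; [:: 25; 28; 29]];
      [:: [:: 0; 17; 28]; [:: 1; 4; 19]; [:: 2; 3; 31]; [:: 5; 7; 24]; [:: 6;
       8; 20]; [:: 9; 27; 29]; [:: 10; 11; 12]; [:: 13; 26; 30]; [:: 14; 15;
       23]; [:: 16; 18; 25]; [:: 21; 22; 32]];
      [:: [:: 0; 9; 18]; [:: 1; 8; 14]; [:: 2; 17; 25]; [:: 3; 16; 29]; [:: 4;
       6; 30]; [:: 5; 11; 32]; [:: 7; 12; 21]; [:: 10; 22; 24]; [:: 13; 15;
       19]; [:: 20; 23; 26]; [:: 27; 28; 31]];
      [:: [:: 0; 5; 13]; [:: 1; 9; 28]; [:: 2; 16; 26]; [:: 3; 22; 23]; [:: 4;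
       24; 27]; [:: 6; 12; 15]; [:: 7; 17; 20]; [:: 8; 25; 32]; [:: 10; 14;
       31]; [:: 11; 29; 30]; [:: 18; 19; 21]];
      [:: [:: 0; 8; 24]; [:: 1; 2; 15]; [:: 3; 4; 32]; [:: 5; 23; 27]; [:: 6;
       9; 26]; [:: 7; 30; 31]; [:: 10; 17; 19]; [:: 11; 18; 20]; [:: 12; 16;
       28]; [:: 13; 22; 25]; [:: 14; 21; 29]];
      [:: [:: 0; 23; 32]; [:: 1; 6; 16]; [:: 2; 9; 12]; [:: 3; 13; 24]; [:: 4;
       5; 25]; [:: 7; 14; 18]; [:: 8; 22; 27]; [:: 10; 20; 29]; [:: 11; 19;
       31]; [:: 15; 26; 28]; [:: 17; 21; 30]];
      [:: [:: 0; 4; 22]; [:: 1; 12; 26]; [:: 2; 6; 28]; [:: 3; 5; 8]; [:: 7;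
       19; 29]; [:: 9; 15; 16]; [:: 10; 18; 30]; [:: 11; 14; 17]; [:: 13; 27;
       32]; [:: 20; 21; 31]; [:: 23; 24; 25]];
      [:: [:: 0; 6; 21]; [:: 1; 3; 11]; [:: 2; 22; 30]; [:: 4; 17; 18]; [:: 5;
       20; 28]; [:: 7; 25; 26]; [:: 8; 29; 31]; [:: 9; 19; 32]; [:: 10; 15;
       27]; [:: 12; 13; 23]; [:: 14; 16; 24]];
      [:: [:: 0; 7; 15]; [:: 1; 21; 25]; [:: 2; 5; 14]; [:: 3; 10; 26]; [:: 4;
       23; 31]; [:: 6; 11; 27]; [:: 8; 13; 17]; [:: 9; 20; 24]; [:: 12; 18;
       29]; [:: 16; 30; 32]; [:: 19; 22; 28]];
      [:: [:: 0; 1; 10]; [:: 2; 20; 32]; [:: 3; 6; 7]; [:: 4; 8; 12]; [:: 5;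
       16; 19]; [:: 9; 14; 22]; [:: 11; 15; 25]; [:: 13; 18; 31]; [:: 17; 23;
       29]; [:: 21; 26; 27]; [:: 24; 28; 30]];
      [:: [:: 0; 11; 26]; [:: 1; 7; 27]; [:: 2; 19; 24]; [:: 3; 15; 21]; [::
       4; 13; 29]; [:: 5; 9; 30]; [:: 6; 10; 25]; [:: 8; 18; 23]; [:: 12; 17;
       31]; [:: 14; 28; 32]; [:: 16; 20; 22]];
      [:: [:: 0; 14; 20]; [:: 1; 5; 29]; [:: 2; 8; 21]; [:: 3; 12; 27]; [:: 4;
       10; 28]; [:: 6; 17; 22]; [:: 7; 13; 16]; [:: 9; 11; 23]; [:: 15; 18;
       32]; [:: 19; 25; 30]; [:: 24; 26; 31]];
      [:: [:: 0; 27; 30]; [:: 1; 18; 22]; [:: 2; 10; 23]; [:: 3; 19; 20]; [::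
       4; 11; 16]; [:: 5; 6; 31]; [:: 7; 8; 9]; [:: 12; 14; 25]; [:: 13; 21;
       28]; [:: 15; 24; 29]; [:: 17; 26; 32]];
      [:: [:: 0; 3; 25]; [:: 1; 31; 32]; [:: 2; 11; 13]; [:: 4; 9; 21]; [:: 5;
       15; 17]; [:: 6; 18; 24]; [:: 7; 23; 28]; [:: 8; 10; 16]; [:: 12; 20;
       30]; [:: 14; 19; 27]; [:: 22; 26; 29]];
      [:: [:: 0; 12; 19]; [:: 1; 17; 24]; [:: 2; 4; 7]; [:: 3; 14; 30]; [:: 5;
       18; 26]; [:: 6; 29; 32]; [:: 8; 11; 28]; [:: 9; 10; 13]; [:: 15; 22;
       31]; [:: 16; 21; 23]; [:: 20; 25; 27]]].

(* Breaking ties between equally constrained points in this order keeps the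
   search tree of [kts33_refuted] small (about 36000 nodes). *)
Definition kts33_order : seq nat :=
  [:: 32; 0; 12; 1; 4; 2; 5; 6; 3; 8; 16; 7; 17; 18; 20; 21; 13; 14; 15; 9;
      28; 10; 29; 11; 30; 24; 22; 25; 23; 26; 27; 31; 19].

Definition kts33_table : seq (seq nat) := Eval vm_compute in
  [seq [seq find (has (fun t => (x \in t) && (y \in t))) kts33_classes
    | y <- iota 0 33] | x <- iota 0 33].

(** A parallel class has a single triple through [x], so the third point is the only other [z] whose
    edge to [x] lies in the same class. On the diagonal the search fails and yields 33. *)
Definition kts33_third : seq (seq nat) := Eval vm_compute in
  let q x y := nth 0 (nth [::] kts33_table x) y in
  [seq [seq find (fun z => [&& x != y, z != x, z != y & q x z == q x y]) (iota 0 33)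
    | y <- iota 0 33] | x <- iota 0 33].

(** * Kirkman triple systems as edge colourings *)

(* A Kirkman triple system is an edge colouring of the complete graph in which
   every colour class is a disjoint union of triangles covering all points; the
   colours are the parallel classes. Values on the diagonal are irrelevant. *)
Section EdgeColouring.

Variables (T J : finType) (q : T -> T -> J).

Definition triangle_edge_colouring : Prop :=
  (forall x y, q x y = q y x) /\
  forall x j, exists y z,
    [/\ uniq [:: x; y; z], q x y = j, q x z = j, q y z = j
      & forall w, w != x -> q x w = j -> w = y \/ w = z].

Definition proper_on_triangles (C : eqType) (c : T -> C) : Prop :=
  forall x y z, uniq [:: x; y; z] -> q x y = q x z -> q y z = q x z ->
    c x = c y -> c x = c z -> False.

Definition joined (j : J) (x y : T) : bool := (x == y) || (q x y == j).

Definition edge_class (j : J) : {set {set T}} :=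
  equivalence_partition (joined j) [set: T].

Definition edge_classes : {set {set {set T}}} := [set edge_class j | j : J].

Definition triangles : {set {set T}} := cover edge_classes.

Hypothesis qP : triangle_edge_colouring.

(** [y] and [z] must be the two points supplied for [x] and this colour. *)
Lemma triangle_closed x y z : x != y -> x != z -> y != z ->
  q x y = q x z -> q y z = q x z.
Proof.
case: qP => _ tri xy xz yz E.
have [a [b [_ _ _ qab only]]] := tri x (q x z).
have /only -/(_ E) : y != x by rewrite eq_sym.
have /only -/(_ erefl) : z != x by rewrite eq_sym.
have [qC _] := qP.
by move: yz => /eqP yz [? [? | ?] | ? [? | ?]]; subst; rewrite // qC.
Qed.

Lemma joined_equiv j : equivalence_rel (joined j).
Proof.
have [qC _] := qP.
have sym x y : joined j x y = joined j y x by rewrite /joined eq_sym qC.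
have tr x y z : joined j x y -> joined j y z -> joined j x z.
  rewrite /joined; have [->//|xy] := eqVneq x y; have [->|yz] := eqVneq y z.
    by move=> /= ->; rewrite orbT.
  have [//|xz] := eqVneq x z => /= /eqP qxy /eqP qyz.
  apply/eqP; rewrite -qyz; apply: (@triangle_closed y) => //; first by rewrite eq_sym.
  by rewrite qC qxy.
move=> x y z; split; first by rewrite /joined eqxx.
move=> xy; apply/idP/idP; last exact: tr.
by apply: tr; rewrite sym.
Qed.

Lemma edge_class_partition j : partition (edge_class j) [set: T].
Proof. by apply: equivalence_partitionP => x y z _ _ _; apply: joined_equiv. Qed.

Lemma edge_classP j b :
  reflect (exists x, b = [set y | joined j x y]) (b \in edge_class j).
Proof.
apply: (iffP imsetP) => [[x _ ->] | [x ->]]; exists x => //;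
  by apply/setP => y; rewrite !inE.
Qed.

Lemma trianglesP b :
  reflect (exists j x, b = [set y | joined j x y]) (b \in triangles).
Proof.
apply: (iffP bigcupP) => [[_ /imsetP[j _ ->] /edge_classP[x ->]] | [j [x ->]]].
  by exists j, x.
by exists (edge_class j); [apply: imset_f | apply/edge_classP; exists x].
Qed.

Lemma triangle_eq j x y : joined j x y ->
  [set z | joined j x z] = [set z | joined j y z].
Proof.
move=> xy; apply/setP => z; rewrite !inE.
by have [_ ->] := joined_equiv j x y z.
Qed.

Lemma triangle_through b x : b \in triangles -> x \in b ->
  exists j, b = [set y | joined j x y].
Proof.
move=> /trianglesP[j [y ->]]; rewrite inE => xy.
by exists j; apply: triangle_eq.
Qed.

Lemma triangle_set j x : exists y z,
  [/\ uniq [:: x; y; z], q x y = j, q x z = j, q y z = j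
    & [set y | joined j x y] = [set x; y; z]].
Proof.
have [_ /(_ x j) [y [z [u xy xz yz only]]]] := qP.
exists y, z; split=> //; apply/setP => w; rewrite !inE /joined.
have [->|xw] := eqVneq x w; first by rewrite ?eqxx.
rewrite /=; apply/eqP/idP.
  by move/only; rewrite eq_sym => /(_ xw) [] ->; rewrite eqxx ?orbT.
by case/orP => /eqP ->.
Qed.

Lemma triangle_edge_colouring_kts (x0 : T) :
  kirkman_triple_system triangles edge_classes.
Proof.
split.
- split=> [b /trianglesP[j [x ->]] | x y xy].
    have [y [z [u _ _ _ ->]]] := triangle_set j x.
    rewrite -[3]/(size [:: x; y; z]) -(card_uniqP u).
    by apply: eq_card => w; rewrite !inE orbA.
  exists [set z | joined (q x y) x z]; split.
    split; first by apply/trianglesP; exists (q x y), x.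
    by rewrite !inE /joined !eqxx orbT.
  move=> b [bB [xb yb]]; have [j bE] := triangle_through bB xb.
  by move: yb; rewrite bE inE /joined (negbTE xy) => /eqP ->.
- apply/and3P; split=> //.
    (* A triangle common to two classes has edges of both colours, so the colours agree. *)
    apply/trivIsetP => _ _ /imsetP[j _ ->] /imsetP[j' _ ->] ne.
    apply/pred0P => b /=; apply/negbTE/negP => /andP[/edge_classP[x ->]].
    move=> /edge_classP[x' bE].
    have [y [z [/= u qy _ _ sE]]] := triangle_set j x.
    have xy : x != y by move: u; rewrite !inE negb_or; case/and3P => /andP[].
    have : joined j' x' x by have /setP /(_ x) := bE; rewrite !inE /joined eqxx.
    move=> /triangle_eq bE'; move: bE; rewrite bE' sE => /setP /(_ y).
    rewrite !inE eqxx orbT /= => /esym; rewrite /joined (negbTE xy) /= qy => /eqP jj.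
    by rewrite jj eqxx in ne.
  (* No class is empty: each contains a triangle through [x0]. *)
  apply/imsetP => -[j _ /setP /(_ [set y | joined j x0 y])].
  by rewrite inE => /esym /edge_classP [] ; exists x0.
- move=> _ /imsetP[j _ ->]; split; last exact: edge_class_partition.
  by apply/subsetP => b bj; apply/bigcupP; exists (edge_class j); rewrite ?imset_f.
Qed.

Lemma colouring_trianglesP d (c : T -> 'I_d) :
  colouring triangles c <-> proper_on_triangles c.
Proof.
split=> [cP x y z u qy qz cy cz | cP _ /trianglesP[j [x ->]] [i mono]].
  have [xy xz] : x != y /\ x != z.
    by move: u; rewrite /= !inE negb_or => /andP[/andP[]].
  have bB : [set w | joined (q x y) x w] \in triangles.
    by apply/trianglesP; exists (q x y), x.
  apply: (cP _ bB); exists (c x) => w; rewrite inE.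
  have [y' [z' [u' qy' qz' _ bE]]] := triangle_set (q x y) x.
  have {}bE w' : joined (q x y) x w' = (w' \in [:: x; y'; z']).
    by have /setP /(_ w') := bE; rewrite !inE orbA.
  (* Three distinct points inside a triangle are all of it. *)
  have : {subset [:: x; y; z] <= [:: x; y'; z']}.
    by move=> w'; rewrite -bE !inE /joined => /or3P[] /eqP->;
      rewrite ?eqxx ?orbT // qy eqxx orbT.
  move=> /(uniq_min_size u) /(_ isT) [_ E]; rewrite bE -E !inE.
  by case/or3P => /eqP ->.
have [y [z [u qy qz qyz bE]]] := triangle_set j x.
have cE w : w \in [:: x; y; z] -> c w = i.
  by move=> h; apply: mono; rewrite bE; move: h; rewrite !inE orbA.
apply: (cP x y z) => //; rewrite ?qy ?qz ?qyz // !cE ?inE ?eqxx ?orbT //.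
Qed.

End EdgeColouring.

(* Addition in the product of the groups Z/d, elements being coded by their
   mixed-radix digits, least significant first. *)
Fixpoint digit_add (ds : seq nat) (x y : nat) : nat :=
  if ds is d :: ds' then (x + y) %% d + d * digit_add ds' (x %/ d) (y %/ d) else 0.

Lemma digit_addC ds x y : digit_add ds x y = digit_add ds y x.
Proof. by elim: ds x y => [|d ds IH] x y /=; [|rewrite IH (addnC x)]. Qed.

(** * Verifying explicit triangle systems by computation *)

Section TriangleCheck.

Variables (n m : nat) (adj cls : rel nat) (q : nat -> nat -> nat) (col : nat -> nat).

(** One test serves both ingredients: [adj] selects the pairs that are edges, and [cls x j] says
    that class [j] has to cover [x], which fails for frame classes missing the group of [x]. *)
Definition triangle_check : bool :=
  all (fun x =>
    let row := [seq (y, q x y) | y <- iota 0 n & adj x y] in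
    all (fun j => cls x j ==>
      if [seq p <- row | p.2 == j] is [:: (y, _); (z, _)] then
        [&& adj y z, q y z == j & ~~ ((col x == col y) && (col x == col z))]
      else false) (iota 0 m)) (iota 0 n).

Lemma triangle_checkP : triangle_check ->
  forall x j, x < n -> j < m -> cls x j ->
  exists y z, [/\ [/\ y < n, z < n & y != z], [/\ adj x y, adj x z & adj y z],
    [/\ q x y = j, q x z = j & q y z = j], ~~ ((col x == col y) && (col x == col z))
    & forall w, w < n -> adj x w -> q x w = j -> w = y \/ w = z].
Proof.
move=> /allP chk x j xn jm xj.
have /chk /allP /(_ j) : x \in iota 0 n by rewrite mem_iota.
rewrite mem_iota add0n => /(_ jm) /implyP /(_ xj).
set row := [seq p <- _ | _].
have rowE p : (p \in row) = [&& p.2 == j, p.1 < n, adj x p.1 & p.2 == q x p.1].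
  rewrite mem_filter; case: (p.2 == j) => //=.
  apply/mapP/and3P => [[y] | [pn xp /eqP pE]].
    by rewrite mem_filter mem_iota add0n => /and3P[xy _ yn] -> /=; rewrite xy yn eqxx.
  by exists p.1; rewrite ?mem_filter ?mem_iota ?add0n ?xp //= -pE; case: (p).
have : uniq row.
  rewrite filter_uniq // map_inj_uniq ?filter_uniq ?iota_uniq // => y y'; by case.
have : {in row, forall p, p.2 = j} by move=> p; rewrite rowE => /andP[/eqP].
case: row rowE => [|[y y2] [|[z z2] [|? ?]]] // rowE jP.
rewrite /= inE => /andP[yz _] /and3P[ayz /eqP qyz nm].
have /= y2E := jP (y, y2) (mem_head _ _).
have /= z2E : (z, z2).2 = j by apply: jP; rewrite !inE eqxx orbT.
have := rowE (y, y2); have := rowE (z, z2).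
rewrite !inE !eqxx orbT y2E z2E eqxx /=.
move=> /esym /and3P[zn xz /eqP qz] /esym /and3P[yn xy /eqP qy].
exists y, z; split=> //.
  by split=> //; apply: contraNneq yz => ->; rewrite y2E z2E.
move=> w wn xw qw; have := rowE (w, j); rewrite /= eqxx wn xw qw eqxx !inE.
by case/orP => /eqP[-> _]; [left | right].
Qed.

End TriangleCheck.

(** On frame points, coded [16 * p + 4 * v_1 + v_2], this is the coordinate [v_1]. *)
Definition col32 (s : nat) : nat := s %/ 4 %% 4.

Definition q33_nat (x y : nat) : nat := nth 0 (nth [::] kts33_table x) y.

Definition neqn : rel nat := fun x y => x != y.

Lemma kts33_check : triangle_check 33 16 neqn (fun _ _ => true) q33_nat col32.
Proof. by vm_cast_no_check (erefl true). Qed.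

Lemma q33_check : all (fun x => all (fun y =>
  (q33_nat x y < 16) && (q33_nat x y == q33_nat y x)) (iota 0 33)) (iota 0 33).
Proof. by vm_cast_no_check (erefl true). Qed.

(** * A Kirkman frame of type 32^4 *)

(* The nonzero vectors of F_3^2 are numbered so that 2a and 2a+1 are opposite;
   these are the lines of AG(2,3) that miss the origin. A line meets three of the
   four groups {2a, 2a+1} and is parallel to the fourth, the group it misses. *)
Definition frame_lines : seq (seq nat) :=
  [:: [:: 0; 2; 5]; [:: 0; 3; 7]; [:: 0; 4; 6]; [:: 1; 2; 6];
      [:: 1; 3; 4]; [:: 1; 5; 7]; [:: 2; 4; 7]; [:: 3; 5; 6]].

(* A nonzero vector p is blown up to the points (p, v) with v in F_4^2, coded
   4 v_1 + v_2 with F_4 = {0, 1, w, w^2} coded 0, 1, 2, 3. A line [:: p_0; p_1; p_2]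
   yields the triples (p_0, x), (p_1, y), (p_2, z) with x + w y + w^2 z = (1, 0), and
   such a triple lies in the class with index x + y. The rows below give this index
   in terms of x + y, of x + z (as w (x + z) + w^2 (1, 0)) and of y + z (as
   w^2 (y + z) + (1, 0)). The first coordinate is a proper colouring because
   1 + w + w^2 = 0 differs from 1. *)
Definition frame_index : seq (seq nat) :=
  [:: iota 0 16;
      [:: 12; 14; 15; 13; 4; 6; 7; 5; 0; 2; 3; 1; 8; 10; 11; 9];
      [:: 4; 7; 5; 6; 8; 11; 9; 10; 0; 3; 1; 2; 12; 15; 13; 14]].

(** The group numbers 0, 1, 2, 3 sum to 6, so [c] is the group missed by the line [l]. Positions
    {0,1}, {0,2}, {1,2} on [l] select rows 0, 1, 2 of [frame_index]. The two lines missing a group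
    are opposite and together cover the other six vectors, so they share their classes. *)
Definition frame_nat (x y : nat) : nat :=
  let p := x %/ 16 in let p' := y %/ 16 in
  let l := nth [::] frame_lines (find (fun l => (p \in l) && (p' \in l)) frame_lines) in
  let c := 6 - sumn [seq r %/ 2 | r <- l] in
  let i := nth 0 (nth [::] frame_index (index p l + index p' l).-1)
             (digit_add [:: 2; 2; 2; 2] (x %% 16) (y %% 16)) in
  16 * c + i.

Definition frame_adj : rel nat := fun x y => x %/ 32 != y %/ 32.
Definition frame_cls : rel nat := fun x j => x %/ 32 != j %/ 16.

Lemma frame_check :
  triangle_check 128 64 frame_adj frame_cls frame_nat col32.
Proof. by vm_cast_no_check (erefl true). Qed.

Lemma frame_miss_check : all (fun x => all (fun y => frame_adj x y ==>
  (let j := frame_nat x y in [&& j < 64, frame_cls x j & frame_cls y j]))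
   (iota 0 128)) (iota 0 128).
Proof. by vm_cast_no_check (erefl true). Qed.

Lemma frame_natC x y : frame_nat x y = frame_nat y x.
Proof.
rewrite /frame_nat (digit_addC _ (x %% 16)).
rewrite (eq_find (a2 := fun l => (y %/ 16 \in l) && (x %/ 16 \in l))); last first.
  by move=> l; rewrite andbC.
by rewrite [index (x %/ 16) _ + _]addnC.
Qed.

Definition enc33 (o : option 'I_32) : nat := if o is Some s then s else 32.

Lemma enc33_lt o : enc33 o < 33.
Proof. by case: o => [s|] //=; rewrite ltnS ltnW. Qed.

Lemma enc33_inj : injective enc33.
Proof.
move=> [s|] [t|] //= E; first by congr Some; apply: val_inj.
  by have := ltn_ord s; rewrite E ltnn.
by have := ltn_ord t; rewrite -E ltnn.
Qed.

Lemma enc33_onto x : x < 33 -> exists o, enc33 o = x.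
Proof.
rewrite ltnS leq_eqVlt => /orP[/eqP->|lt]; first by exists None.
by exists (Some (Ordinal lt)).
Qed.

Definition q33 (x y : option 'I_32) : 'I_16 := inord (q33_nat (enc33 x) (enc33 y)).

Lemma q33_nat_bound x y : x < 33 -> y < 33 ->
  q33_nat x y < 16 /\ q33_nat x y = q33_nat y x.
Proof.
move=> xn yn.
have /allP /(_ x) := q33_check; rewrite mem_iota => /(_ xn) /allP /(_ y).
by rewrite mem_iota => /(_ yn) /andP[-> /eqP].
Qed.

Lemma val_q33 x y : q33 x y = q33_nat (enc33 x) (enc33 y) :> nat.
Proof. by rewrite inordK //; case: (q33_nat_bound (enc33_lt x) (enc33_lt y)). Qed.

Definition c33 (o : option 'I_32) : 'I_4 := inord (col32 (enc33 o)).

Lemma val_c33 o : c33 o = col32 (enc33 o) :> nat.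
Proof. by rewrite inordK // ltn_mod. Qed.

Lemma q33_spec x j : exists y z,
  [/\ uniq [:: x; y; z], q33 x y = j, q33 x z = j,
      q33 y z = j /\ ~~ ((c33 x == c33 y) && (c33 x == c33 z))
    & forall w, w != x -> q33 x w = j -> w = y \/ w = z].
Proof.
have [y' [z' [[yn zn yz] [xy xz _] [qxy qxz qyz] nm only]]] :=
  triangle_checkP kts33_check (enc33_lt x) (ltn_ord j) isT.
have [y yE] := enc33_onto yn; have [z zE] := enc33_onto zn.
subst y' z'; exists y, z; split.
- rewrite /= !inE -!(inj_eq enc33_inj) yz andbT negb_or.
  by move: xy xz; rewrite /neqn => -> ->.
- by apply: val_inj; rewrite /= val_q33.
- by apply: val_inj; rewrite /= val_q33.
- by split; [apply: val_inj; rewrite /= val_q33 | rewrite -!(inj_eq val_inj) /= !val_c33].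
move=> w wx qw.
have /only : enc33 w < 33 by apply: enc33_lt.
rewrite /neqn (inj_eq enc33_inj) eq_sym -val_q33 qw => /(_ wx erefl).
by case=> /enc33_inj ->; [left | right].
Qed.

Lemma q33_edge_colouring : triangle_edge_colouring q33.
Proof.
split=> [x y | x j].
  by apply: val_inj; rewrite /= !val_q33; case: (q33_nat_bound (enc33_lt x) (enc33_lt y)).
by have [y [z [u a b [c _] d]]] := q33_spec x j; exists y, z.
Qed.

Lemma proper_of_spec (T J : finType) (q : T -> T -> J) (C : eqType) (c : T -> C) :
  (forall x j, exists y z, [/\ uniq [:: x; y; z],
     ~~ ((c x == c y) && (c x == c z))
   & forall w, w != x -> q x w = j -> w = y \/ w = z]) ->
  proper_on_triangles q c.
Proof.
move=> spec x y z u qy qz cy cz.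
have [y' [z' [u' nm only]]] := spec x (q x z).
have [[xy xz] yz] : (x != y /\ x != z) /\ y != z.
  by move: u; rewrite /= !inE negb_or => /and3P[/andP[]].
have /only -/(_ qy) yE : y != x by rewrite eq_sym.
have /only -/(_ erefl) zE : z != x by rewrite eq_sym.
have [E1 E2] : c y' = c x /\ c z' = c x.
  by move: yz => /eqP yz; case: yE zE => [? [?|?]|? [?|?]]; subst.
by rewrite E1 E2 eqxx in nm.
Qed.

Definition enc_pt (p : 'I_4 * 'I_32) : nat := 32 * p.1 + p.2.
Definition enc_cl (j : 'I_4 * 'I_16) : nat := 16 * j.1 + j.2.
Definition dec_cl (j : nat) : 'I_4 * 'I_16 := (inord (j %/ 16), inord (j %% 16)).
Definition dec_pt (x : nat) : 'I_4 * 'I_32 := (inord (x %/ 32), inord (x %% 32)).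

Lemma enc_pt_lt p : enc_pt p < 128.
Proof. rewrite /enc_pt; have := ltn_ord p.1; have := ltn_ord p.2; lia. Qed.

Lemma enc_cl_lt p : enc_cl p < 64.
Proof. rewrite /enc_cl; have := ltn_ord p.1; have := ltn_ord p.2; lia. Qed.

Lemma enc_pt_div p : enc_pt p %/ 32 = p.1.
Proof. rewrite /enc_pt; have := ltn_ord p.2; lia. Qed.

Lemma enc_cl_div p : enc_cl p %/ 16 = p.1.
Proof. rewrite /enc_cl; have := ltn_ord p.2; lia. Qed.

Lemma dec_clK j : j < 64 -> enc_cl (dec_cl j) = j.
Proof. move=> h; rewrite /enc_cl /= !inordK; lia. Qed.

Lemma dec_ptK j : j < 128 -> enc_pt (dec_pt j) = j.
Proof. move=> h; rewrite /enc_pt /= !inordK; lia. Qed.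

Lemma enc_clK : cancel enc_cl dec_cl.
Proof.
move=> [a i]; have ha := ltn_ord a; have hi := ltn_ord i.
by congr pair; apply: val_inj; rewrite /= inordK /enc_cl /=; lia.
Qed.

Lemma enc_ptK : cancel enc_pt dec_pt.
Proof.
move=> [a i]; have ha := ltn_ord a; have hi := ltn_ord i.
by congr pair; apply: val_inj; rewrite /= inordK /enc_pt /=; lia.
Qed.

Definition frame (p p' : 'I_4 * 'I_32) : 'I_4 * 'I_16 :=
  dec_cl (frame_nat (enc_pt p) (enc_pt p')).

Definition c32 (s : 'I_32) : 'I_4 := inord (col32 s).

Lemma frameC p p' : frame p p' = frame p' p.
Proof. by rewrite /frame frame_natC. Qed.

Lemma frame_adjE p p' : frame_adj (enc_pt p) (enc_pt p') = (p.1 != p'.1).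
Proof. by rewrite /frame_adj !enc_pt_div (inj_eq val_inj). Qed.

Lemma frame_clsE p j : frame_cls (enc_pt p) (enc_cl j) = (p.1 != j.1).
Proof. by rewrite /frame_cls enc_pt_div enc_cl_div (inj_eq val_inj). Qed.

Lemma enc_frame p p' : p.1 != p'.1 ->
  enc_cl (frame p p') = frame_nat (enc_pt p) (enc_pt p')
  /\ (p.1 != (frame p p').1) && (p'.1 != (frame p p').1).
Proof.
rewrite -!frame_clsE -frame_adjE => adj.
have /allP /(_ (enc_pt p)) := frame_miss_check.
rewrite mem_iota => /(_ (enc_pt_lt p)) /allP /(_ (enc_pt p')).
rewrite mem_iota => /(_ (enc_pt_lt p')) /implyP /(_ adj) /= /and3P[lt a b].
by rewrite /frame dec_clK // a b.
Qed.

(** Adding a multiple of 32 changes the quotient by 4 by a multiple of 8, so every group is coloured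
    alike. *)
Lemma val_c32 p : c32 p.2 = col32 (enc_pt p) :> nat.
Proof.
rewrite inordK ?ltn_mod // /col32 /enc_pt.
have := ltn_ord p.2; lia.
Qed.

Lemma frame_spec p j : p.1 != j.1 -> exists y z,
  [/\ [/\ p.1 != y.1, p.1 != z.1 & y.1 != z.1],
      [/\ frame p y = j, frame p z = j & frame y z = j],
      ~~ ((c32 p.2 == c32 y.2) && (c32 p.2 == c32 z.2))
    & forall w, p.1 != w.1 -> frame p w = j -> w = y \/ w = z].
Proof.
rewrite -frame_clsE => pj.
have [y' [z' [[yn zn yz] [xy xz ayz] [qxy qxz qyz] nm only]]] :=
  triangle_checkP frame_check (enc_pt_lt p) (enc_cl_lt j) pj.
rewrite -(dec_ptK yn) -(dec_ptK zn) in xy xz ayz qxy qxz qyz nm only.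
move: (dec_pt y') (dec_pt z') => y z in xy xz ayz qxy qxz qyz nm only *.
exists y, z; split.
- by rewrite -!frame_adjE.
- by rewrite /frame qxy qxz qyz enc_clK.
- by rewrite -!(inj_eq val_inj) /= !val_c32.
move=> w; rewrite -frame_adjE => pw qw.
have /only : enc_pt w < 128 by apply: enc_pt_lt.
have [<- _] := enc_frame (etrans (esym (frame_adjE p w)) pw); rewrite qw.
by move=> /(_ pw erefl) [] /(can_inj enc_ptK) ->; [left | right].
Qed.

(** * The KTS(33) has no 3-colouring *)

Definition kts33_start : seq cell :=
  [:: (32, [:: 0]), (0, [:: 0; 1])
    & [seq (x, [:: 0; 1; 2]) | x <- drop 2 kts33_order]].

Lemma kts33_refuted : refute kts33_third 33 33 [::] kts33_start.
Proof. by vm_cast_no_check (erefl true). Qed.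

Lemma kts33_third_check : all (fun x => all (fun y =>
  let z := nth 33 (nth [::] kts33_third x) y in
  (z < 33) ==> [&& x != y, x != z, y != z, q33_nat x y == q33_nat x z
                 & q33_nat y z == q33_nat x z])
  (iota 0 33)) (iota 0 33).
Proof. by vm_cast_no_check (erefl true). Qed.

Lemma kts33_third_size :
  (size kts33_third == 33) && all (fun r => size r == 33) kts33_third.
Proof. by vm_compute. Qed.

Lemma kts33_thirdP x y (z := nth 33 (nth [::] kts33_third x) y) : z < 33 ->
  [/\ x < 33, y < 33, [&& x != y, x != z & y != z],
      q33_nat x y = q33_nat x z & q33_nat y z = q33_nat x z].
Proof.
move=> zn; have /andP[/eqP sz /allP szr] := kts33_third_size.
have xn : x < 33.
  by rewrite ltnNge; apply/negP => h; move: zn; rewrite /z (nth_default [::]) ?sz ?nth_nil.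
have yn : y < 33.
  rewrite ltnNge; apply/negP => h; move: zn; rewrite /z nth_default // (eqP (szr _ _)) //.
  by rewrite mem_nth ?sz.
have /allP /(_ x) := kts33_third_check; rewrite mem_iota => /(_ xn) /allP /(_ y).
by rewrite mem_iota => /(_ yn) /implyP /(_ zn) /and5P[-> -> -> /eqP-> /eqP].
Qed.

(** Symmetry breaking: a permutation of the colours gives point 32 colour 0 and point 0 colour 0 or
    1, as [kts33_start] assumes. *)
Lemma normalise_colours a b : a < 3 -> b < 3 -> exists s : seq nat,
  [/\ size s = 3, uniq s, all (ltn^~ 3) s, nth 0 s a = 0 & nth 0 s b <= 1].
Proof.
case: a => [|[|[|a]]] // _; case: b => [|[|[|b]]] // _.
- by exists [:: 0; 1; 2].
- by exists [:: 0; 1; 2].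
- by exists [:: 0; 2; 1].
- by exists [:: 1; 0; 2].
- by exists [:: 1; 0; 2].
- by exists [:: 2; 0; 1].
- by exists [:: 1; 2; 0].
- by exists [:: 2; 1; 0].
- by exists [:: 1; 2; 0].
Qed.

Lemma q33_not_3_colourable (c : option 'I_32 -> nat) :
  (forall x, c x < 3) -> ~ proper_on_triangles q33 c.
Proof.
move=> c3 cP.
(* [insub] inverts [enc33]; in particular [insub 32] is the point at infinity. *)
have [s [sz su s3 s0 s1]] := normalise_colours (c3 (insub 32)) (c3 (insub 0)).
pose c' x := nth 0 s (c (insub x)).
suff : ~~ refute kts33_third 33 33 [::] kts33_start by rewrite kts33_refuted.
apply: (@refute_sound kts33_third 33 c') => //.
- by move=> x; apply: (all_nthP 0 s3); rewrite sz.
- move=> x y z zn; have [xn yn /and3P[xy xz yz] qxy qyz] := kts33_thirdP zn.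
  have c'E u v : (c' u == c' v) = (c (insub u) == c (insub v)).
    by rewrite /c' nth_uniq ?sz.
  have insE u : u < 33 -> enc33 (insub u) = u.
    by move=> un; case: insubP => [w _ //|] /=; lia.
  have inj u v : u < 33 -> v < 33 -> u != v -> insub u != insub v :> option 'I_32.
    by move=> un vn uv; rewrite -(inj_eq enc33_inj) !insE.
  move=> /eqP; rewrite c'E => /eqP cxy /eqP; rewrite c'E => /eqP cxz.
  apply: cP cxy cxz; rewrite /= ?inE ?negb_or ?inj //.
  + by apply: val_inj; rewrite /= !val_q33 !insE.
  + by apply: val_inj; rewrite /= !val_q33 !insE.
apply/allP => -[x d]; rewrite in_cons in_cons => /or3P[/eqP[-> ->] | /eqP[-> ->] | /mapP].
- by rewrite /= inE /c' s0.
- by rewrite /= !inE /c'; case: (nth 0 s _) s1 => [|[]].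
case=> y y_in [-> ->] /=; have -> : y < 33.
  by move: y y_in; apply/allP; vm_compute.
by have := (all_nthP 0 s3) (c (insub y)); rewrite sz !inE -/(c' y) => /(_ (c3 _));
  case: (c' y) => [|[|[|]]].
Qed.

(** * Decompositions into blocks of size four *)

(** An edge decomposition of the graph [R] into copies of K_4. Blocks are maps from ['I_4], so that
    the four frame groups can be attached to their points; the third condition also excludes two
    labellings of one block. *)
Definition k4_decomposable (U : finType) (R : rel U) : Prop :=
  exists D : {set {ffun 'I_4 -> U}},
  [/\ forall b i j, b \in D -> i != j -> R (b i) (b j),
      forall x y, R x y -> exists b i j, [/\ b \in D, b i = x & b j = y]
    & forall b b' i j i' j', b \in D -> b' \in D -> i != j ->
        b i = b' i' -> b j = b' j' -> b = b'].

Lemma k4_decomposable_image (U V : finType) (f : V -> U) (R : rel V) (R' : rel U) :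
  injective f -> (forall u v, R u v -> R' (f u) (f v)) ->
  (forall x y, R' x y -> exists u v, [/\ f u = x, f v = y & R u v]) ->
  k4_decomposable R -> k4_decomposable R'.
Proof.
move=> f_inj RR' R'R [D [D1 D2 D3]].
exists [set [ffun i => f (b i)] | b : {ffun 'I_4 -> V} in D]; split.
- move=> _ i j /imsetP[b bD ->] ij; rewrite !ffunE; exact/RR'/D1.
- move=> _ _ /R'R[u [v [<- <- /D2[b [i [j [bD <- <-]]]]]]].
  by exists [ffun i => f (b i)], i, j; rewrite !ffunE; split=> //; apply: imset_f.
move=> _ _ i j i' j' /imsetP[b bD ->] /imsetP[b' b'D ->] ij.
rewrite !ffunE => /f_inj Ei /f_inj Ej.
by rewrite (D3 b b' i j i' j').
Qed.

Lemma k4_decomposable_union (U P : finType) (Rp : P -> rel U) (R : rel U) :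
  irreflexive R -> (forall x y, R x y <-> exists p, Rp p x y) ->
  (forall p p' x y, Rp p x y -> Rp p' x y -> p = p') ->
  (forall p, k4_decomposable (Rp p)) -> k4_decomposable R.
Proof.
move=> Rirr RE disj /fin_all_exists[D DP].
exists (\bigcup_p D p); split.
- move=> b i j /bigcupP[p _ bD] ij; apply/RE; exists p.
  by case: (DP p) => D1 _ _; apply: D1.
- move=> x y /RE[p Rxy]; case: (DP p) => _ /(_ x y Rxy) [b [i [j [bD Ei Ej]]]] _.
  by exists b, i, j; split=> //; apply/bigcupP; exists p.
move=> b b' i j i' j' /bigcupP[p _ bD] /bigcupP[p' _ b'D] ij Ei Ej.
have [D1 _ D3] := DP p; have [D1' _ _] := DP p'.
have Rij := D1 b i j bD ij.
have ij' : i' != j'.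
  apply/eqP => E; have : R (b i) (b j) by apply/RE; exists p.
  by rewrite Ei Ej E Rirr.
have Rij' := D1' b' i' j' b'D ij'; rewrite -Ei -Ej in Rij'.
have E := disj p p' _ _ Rij Rij'; subst p'.
exact: (D3 b b' i j i' j').
Qed.

Definition neq_rel (U : finType) : rel U := fun x y => x != y.

(** A Steiner system S(2,4,u), seen as a decomposition of the complete graph. *)
Definition steiner4 (u : nat) : Prop := k4_decomposable (@neq_rel 'I_u).

Lemma card_eq_bij (U V : finType) : #|U| = #|V| -> exists f : U -> V, bijective f.
Proof.
move=> E; exists (fun x => enum_val (cast_ord E (enum_rank x))).
exists (fun y => enum_val (cast_ord (esym E) (enum_rank y))) => x.
  by rewrite enum_valK cast_ordK enum_rankK.
by rewrite enum_valK cast_ordKV enum_rankK.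
Qed.

Lemma k4_decomposable_neq_card (U V : finType) : #|U| = #|V| ->
  k4_decomposable (@neq_rel U) -> k4_decomposable (@neq_rel V).
Proof.
move=> /card_eq_bij[f [g fK gK]]; apply: (@k4_decomposable_image _ _ f).
- exact: can_inj fK.
- by move=> u v; rewrite /neq_rel (inj_eq (can_inj fK)).
- by move=> x y xy; exists (g x), (g y); rewrite !gK /neq_rel (inj_eq (can_inj gK)).
Qed.

Lemma steiner4P (U : finType) u : #|U| = u ->
  steiner4 u <-> k4_decomposable (@neq_rel U).
Proof.
by move=> E; split; apply: k4_decomposable_neq_card; rewrite card_ord E.
Qed.

(** A group divisible design with blocks of size four and one group of size three for each element
    of [H]. *)
Definition gdd3 (H : finType) : Prop :=
  k4_decomposable (fun a b : 'I_3 * H => a.2 != b.2).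

(** * Verifying explicit block designs by computation *)

Section DesignCheck.

Variables (n : nat) (R : rel nat) (bl : seq (seq nat)).

Definition neighbours (x : nat) : seq nat :=
  flatten [seq [seq y <- b | y != x] | b <- bl & x \in b].

(** A pair [x], [y] in two blocks makes [y] occur twice among the neighbours of [x], so [uniq]
    expresses that no pair is covered twice. *)
Definition design_check : bool :=
  all (fun b => [&& size b == 4, uniq b & all (ltn^~ n.+1) b]) bl &&
  all (fun x => let nb := neighbours x in
    uniq nb && all (fun y => (y \in nb) == R x y) (iota 0 n.+1)) (iota 0 n.+1).

Lemma uniq_flatten_map (S T : eqType) (F : S -> seq T) (s : seq S) x y z :
  uniq (flatten [seq F x | x <- s]) -> x \in s -> y \in s ->
  z \in F x -> z \in F y -> x = y.
Proof.
elim: s => //= w s IH; rewrite cat_uniq => /and3P[_ /hasPn dis us].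
rewrite !inE => /orP[/eqP->|xs] /orP[/eqP->|ys] // zx zy.
- have /dis : z \in flatten [seq F x | x <- s] by apply/flatten_mapP; exists y.
  by rewrite zx.
- have /dis : z \in flatten [seq F x | x <- s] by apply/flatten_mapP; exists x.
  by rewrite zy.
exact: IH.
Qed.

Lemma design_check_k4_decomposable : design_check ->
  k4_decomposable (fun x y : 'I_n.+1 => R x y).
Proof.
move=> /andP[/allP blP /allP nbP].
have bsz b : b \in bl -> size b = 4 by move=> /blP /and3P[/eqP].
have bu b : b \in bl -> uniq b by move=> /blP /and3P[].
have bn b x : b \in bl -> x \in b -> x < n.+1 by move=> /blP /and3P[_ _ /allP h] /h.
have nbE x y : x < n.+1 -> y < n.+1 -> (y \in neighbours x) = R x y.
  move=> xn yn; have /nbP /andP[_ /allP /(_ y)] : x \in iota 0 n.+1 by rewrite mem_iota.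
  by rewrite mem_iota => /(_ yn) /eqP.
have nbu x : x < n.+1 -> uniq (neighbours x).
  by move=> xn; have /nbP /andP[] : x \in iota 0 n.+1 by rewrite mem_iota.
have mem_nb x y : reflect (exists2 b, b \in bl & [&& x \in b, y \in b & y != x])
    (y \in neighbours x).
  apply: (iffP flatten_mapP) => [[b] | [b bb /and3P[xb yb yx]]].
    rewrite !mem_filter => /andP[xb bb] /andP[yx yb].
    by exists b => //; rewrite xb yb.
  by exists b; rewrite !mem_filter ?xb ?yx.
pose mk (b : seq nat) : {ffun 'I_4 -> 'I_n.+1} := [ffun i : 'I_4 => inord (nth 0 b i)].
have in_b b (i : 'I_4) : b \in bl -> nth 0 b i \in b.
  by move=> bb; rewrite mem_nth // bsz.
have mkE b (i : 'I_4) : b \in bl -> mk b i = nth 0 b i :> nat.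
  by move=> bb; rewrite ffunE inordK // (bn b) // in_b.
have nth_neq b (i j : 'I_4) : b \in bl -> i != j -> nth 0 b i != nth 0 b j.
  by move=> bb ij; rewrite nth_uniq ?bsz ?bu.
exists [set f in [seq mk b | b <- bl]]; split.
- move=> f i j; rewrite inE => /mapP[b bb ->] ij.
  rewrite -nbE // !mkE //; apply/mem_nb; exists b => //.
  by rewrite !in_b //= nth_neq // eq_sym.
- move=> x y; rewrite -nbE // => /mem_nb[b bb /and3P[xb yb yx]].
  have ix : index (val x) b < 4 by rewrite -(bsz b bb) index_mem.
  have iy : index (val y) b < 4 by rewrite -(bsz b bb) index_mem.
  exists (mk b), (Ordinal ix), (Ordinal iy); split.
  + by rewrite inE map_f.
  + by apply: val_inj; rewrite /= mkE //= nth_index.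
  + by apply: val_inj; rewrite /= mkE //= nth_index.
move=> f f' i j i' j'; rewrite !inE => /mapP[b bb ->] /mapP[b' bb' ->] ij.
move=> /(congr1 val) /=; rewrite !mkE // => Ei.
move=> /(congr1 val) /=; rewrite !mkE // => Ej.
set x := nth 0 b i in Ei; set y := nth 0 b j in Ej.
have yx : y != x by rewrite eq_sym nth_neq.
have xn : x < n.+1 by apply: bn (in_b b i bb).
congr mk; apply: (uniq_flatten_map (nbu x xn) (z := y)); rewrite mem_filter ?in_b //.
- by rewrite bb' Ei in_b.
- by rewrite yx ?in_b.
- by rewrite yx Ej in_b.
Qed.

End DesignCheck.

(* Each base block is translated by the first [p.2] group elements; the label [g]
   stands for a point fixed by the translations. *)
Definition developed (g : nat) (ds : seq nat) (base : seq (seq nat * nat)) :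
    seq (seq nat) :=
  flatten [seq [seq [seq (if e == g then e else digit_add ds e x) | e <- p.1]
              | x <- iota 0 p.2] | p <- base].

(** * Small Steiner systems and group divisible designs *)

Lemma steiner4_check n bl : design_check n neqn bl -> steiner4 n.+1.
Proof. exact: (@design_check_k4_decomposable n neqn). Qed.

Lemma steiner4_1 : steiner4 1.
Proof. by apply: (@steiner4_check _ [::]); vm_compute. Qed.

Lemma steiner4_4 : steiner4 4.
Proof. by apply: (@steiner4_check _ [:: [:: 0; 1; 2; 3]]); vm_compute. Qed.

Lemma steiner4_13 : steiner4 13.
Proof.
apply: (@steiner4_check _ (developed 13 [:: 13] [:: ([:: 0; 1; 4; 6], 13)])).
by vm_cast_no_check (erefl true).
Qed.

(** The first base block is the fixed point 15 with the subgroup of order 3 and has only 5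
    translates; the second yields each difference that is not a multiple of 5 once. *)
Lemma steiner4_16 : steiner4 16.
Proof.
apply: (@steiner4_check _
  (developed 15 [:: 15] [:: ([:: 15; 0; 5; 10], 5); ([:: 0; 1; 3; 7], 15)])).
by vm_cast_no_check (erefl true).
Qed.

Lemma steiner4_25 : steiner4 25.
Proof.
apply: (@steiner4_check _
  (developed 25 [:: 5; 5] [:: ([:: 0; 1; 16; 22], 25); ([:: 0; 2; 7; 19], 25)])).
by vm_cast_no_check (erefl true).
Qed.

Lemma steiner4_28 : steiner4 28.
Proof.
apply: (@steiner4_check _
  (developed 27 [:: 3; 3; 3] [:: ([:: 27; 0; 9; 18], 9); ([:: 0; 1; 8; 16], 27);
                                 ([:: 0; 3; 17; 20], 27)])).
by vm_cast_no_check (erefl true).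
Qed.

Lemma steiner4_37 : steiner4 37.
Proof.
apply: (@steiner4_check _
  (developed 37 [:: 37] [:: ([:: 0; 1; 13; 30], 37); ([:: 0; 2; 23; 34], 37);
                            ([:: 0; 4; 10; 19], 37)])).
by vm_cast_no_check (erefl true).
Qed.

Lemma steiner4_40 : steiner4 40.
Proof.
apply: (@steiner4_check _
  (developed 40 [:: 40] [:: ([:: 0; 10; 20; 30], 10); ([:: 0; 1; 9; 35], 40);
                            ([:: 0; 2; 24; 27], 40); ([:: 0; 4; 11; 23], 40)])).
by vm_cast_no_check (erefl true).
Qed.

Lemma steiner4_85 : steiner4 85.
Proof.
apply: (@steiner4_check _
  (developed 85 [:: 85]
    [seq (b, 85) | b <- [:: [:: 0; 1; 25; 42]; [:: 0; 2; 21; 72]; [:: 0; 3; 12; 62];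
       [:: 0; 4; 33; 79]; [:: 0; 5; 36; 74]; [:: 0; 7; 27; 55]; [:: 0; 8; 53; 71]]])).
by vm_cast_no_check (erefl true).
Qed.

Lemma steiner4_88 : steiner4 88.
Proof.
apply: (@steiner4_check _
  (developed 88 [:: 88] (([:: 0; 22; 44; 66], 22) ::
    [seq (b, 88) | b <- [:: [:: 0; 1; 64; 71]; [:: 0; 2; 42; 53]; [:: 0; 3; 31; 50];
       [:: 0; 4; 27; 59]; [:: 0; 5; 72; 78]; [:: 0; 8; 62; 76]; [:: 0; 9; 45; 58]]]))).
by vm_cast_no_check (erefl true).
Qed.

Lemma gdd3_check k (H : finType) (bl : seq (seq nat)) : #|H| = k.+1 ->
  design_check (3 * k.+1).-1 (fun x y => x %% k.+1 != y %% k.+1) bl -> gdd3 H.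
Proof.
move=> cH /design_check_k4_decomposable.
have [h [h' hK h'K]] : exists h : 'I_k.+1 -> H, bijective h.
  by apply: card_eq_bij; rewrite card_ord.
(* The groups become the residue classes modulo [k.+1]. *)
pose f (a : 'I_(3 * k.+1).-1.+1) : 'I_3 * H := (inord (a %/ k.+1), h (inord (a %% k.+1))).
pose g (a : 'I_3 * H) : 'I_(3 * k.+1).-1.+1 := inord (a.1 * k.+1 + h' a.2).
have ha (a : 'I_(3 * k.+1).-1.+1) : a < 3 * k.+1 by have := ltn_ord a; lia.
have fK : cancel f g.
  move=> a; apply: val_inj; rewrite /f /g /= hK !inordK ?ltn_mod ?ltn_divLR //.
  - by rewrite -divn_eq.
  - by rewrite -divn_eq.
have gK : cancel g f.
  move=> [l x]; have gE : g (l, x) = l * k.+1 + h' x :> nat.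
    rewrite /g inordK //=; have := ltn_ord l; have := ltn_ord (h' x); nia.
  rewrite /f gE divnMDl // modnMDl divn_small // modn_small // addn0.
  by rewrite !inord_val h'K.
have f2 a : (f a).2 = h (inord (a %% k.+1)) by [].
have fE a b : ((f a).2 == (f b).2) = (a %% k.+1 == b %% k.+1).
  by rewrite !f2 (inj_eq (can_inj hK)) -(inj_eq val_inj) /= !inordK ?ltn_mod.
apply: (@k4_decomposable_image _ _ f) => [|a b ab|x y xy].
- exact: can_inj fK.
- by rewrite fE.
- by exists (g x), (g y); rewrite !gK -fE !gK.
Qed.

(** Type 3^4 is a transversal design TD(4,3). *)
Lemma gdd3_4 (H : finType) : #|H| = 4 -> gdd3 H.
Proof.
move=> cH; apply: (@gdd3_check 3 H
  [:: [:: 0; 1; 2; 3]; [:: 0; 5; 6; 11]; [:: 0; 9; 10; 7];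
  [:: 4; 1; 6; 7]; [:: 4; 5; 10; 3]; [:: 4; 9; 2; 11];
  [:: 8; 1; 10; 11]; [:: 8; 5; 2; 7]; [:: 8; 9; 6; 3]]); last by vm_compute.
by rewrite cH.
Qed.

(** This is the S(2,4,16) above without its fixed point: the blocks through that point become the
    groups. *)
Lemma gdd3_5 (H : finType) : #|H| = 5 -> gdd3 H.
Proof.
move=> cH; apply: (@gdd3_check 4 H (developed 15 [:: 15] [:: ([:: 0; 1; 3; 7], 15)])).
  by rewrite cH.
by vm_compute.
Qed.

(** * Transversal designs TD(5,m) *)

(* A transversal design TD(5, G) with the blocks
   {(0, t 0 x y), ..., (3, t 3 x y), (4, x)} for x, y in G. *)
Definition has_td5 (G : finType) : Prop :=
  exists t : 'I_4 -> G -> G -> G,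
    (forall i x, injective (t i x)) /\
    (forall i j, i != j -> injective (fun p : G * G => (t i p.1 p.2, t j p.1 p.2))).

Lemma has_td5_card (G H : finType) : #|G| = #|H| -> has_td5 G -> has_td5 H.
Proof.
move=> /card_eq_bij[f [g fK gK]] [t [t1 t2]].
have gI := can_inj gK; have fI := can_inj fK.
exists (fun i x y => f (t i (g x) (g y))); split=> [i x y y' /fI /t1 /gI // | i j ij].
move=> [x y] [x' y'] /= [/fI E1 /fI E2].
by have [/gI -> /gI ->] := t2 i j ij (g x, g y) (g x', g y') (congr2 pair E1 E2).
Qed.

Lemma has_td5_prod (G H : finType) : has_td5 G -> has_td5 H -> has_td5 (G * H)%type.
Proof.
move=> [t [t1 t2]] [s [s1 s2]].
exists (fun i x y => (t i x.1 y.1, s i x.2 y.2)); split.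
  by move=> i x [y z] [y' z'] /= [/t1 -> /s1 ->].
move=> i j ij [[x z] [y w]] [[x' z'] [y' w']] /= [E1 E2 E3 E4].
have [-> ->] := t2 i j ij (x, y) (x', y') (congr2 pair E1 E3).
by have [-> ->] := s2 i j ij (z, w) (z', w') (congr2 pair E2 E4).
Qed.

(** Take [i * x + y] modulo [m]: two rows differ by a multiplier 1, 2 or 3, which is invertible
    modulo [m]. *)
Lemma has_td5_coprime6 m : coprime m 6 -> has_td5 'I_m.
Proof.
case: m => [|m] co.
  by exists (fun _ x _ => x); split=> [i []//|i j _ [[]]//].
have can d x x' : 0 < d -> d < 4 -> x < m.+1 -> x' < m.+1 ->
    d * x = d * x' %[mod m.+1] -> x = x'.
  move=> d0 d4; wlog le : x x' / x' <= x.
    move=> wl xm x'm E; have [h|/ltnW h] := leqP x' x; first exact: wl.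
    by symmetry; apply: wl.
  move=> xm x'm /eqP; rewrite eqn_mod_dvd ?leq_mul2l ?le ?orbT // -mulnBr.
  rewrite Gauss_dvdr.
    by move=> dv; have [h|/dvdn_leq /(_ dv)] := posnP (x - x'); lia.
  have [/eqP->|/eqP->|/eqP->] : [\/ d == 1, d == 2 | d == 3].
      by case: d d0 d4 => [|[|[|[|]]]] //; constructor.
  - exact: coprimen1.
  - by apply: coprime_dvdr co.
  - by apply: coprime_dvdr co.
pose t (i : 'I_4) (x y : 'I_m.+1) : 'I_m.+1 := inord ((i * x + y) %% m.+1).
have tE i x y : t i x y = (i * x + y) %% m.+1 :> nat by rewrite inordK ?ltn_mod.
exists t; split.
  move=> i x y y' /(congr1 val) /=; rewrite !tE => /eqP; rewrite eqn_modDl.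
  by rewrite !modn_small // => /eqP /val_inj.
move=> i j; wlog ij : i j / i < j.
  move=> wl ij; have [h|h|/val_inj h] := ltngtP i j; first exact: wl.
    have ji : j != i by rewrite eq_sym.
    by move=> p p' [E1 E2]; apply: (wl j i h ji); rewrite /= E1 E2.
  by rewrite h eqxx in ij.
move=> _ [x y] [x' y'] /= [/(congr1 val) /= E1 /(congr1 val) /= E2].
rewrite !tE in E1 E2.
have xx : x = x'.
  apply: val_inj; apply: (can (j - i)) => //=; first by rewrite subn_gt0.
    by apply: leq_ltn_trans (leq_subr _ _) _.
  have jE (a b : nat) : j * a + b = (i * a + b) + (j - i) * a.
    have : i * a <= j * a by rewrite leq_mul2r (ltnW ij) orbT.
    by rewrite mulnBl; lia.
  move: E2; rewrite !jE -modnDml E1 modnDml => /eqP.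
  by rewrite eqn_modDl => /eqP.
subst x'; congr pair; move: E1 => /eqP; rewrite eqn_modDl !modn_small //.
by move=> /eqP /val_inj.
Qed.

Lemma uniq_map_inj (S T : eqType) (f : S -> T) (s : seq S) x y :
  uniq [seq f x | x <- s] -> x \in s -> y \in s -> f x = f y -> x = y.
Proof.
move=> u xs ys E.
have eqi : index x s = index y s.
  apply/eqP; rewrite -(nth_uniq (f x) _ _ u) ?size_map ?index_mem //.
  by rewrite !(nth_map x) ?index_mem // !nth_index ?E.
by rewrite -(nth_index x xs) eqi nth_index.
Qed.

(* The rows form a difference matrix: the translates of its columns are the
   blocks of the transversal design. *)
Section TransversalCheck.

Variables (m : nat) (ds : seq nat) (rows : seq (seq nat)).

Definition difference_td (i : nat) (p : nat * nat) : nat :=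
  digit_add ds (nth 0 (nth [::] rows i) p.1) p.2.

Definition grid : seq (nat * nat) := [seq (x, y) | x <- iota 0 m.+1, y <- iota 0 m.+1].

Definition td5_check : bool :=
  all (fun i =>
    all (fun p => difference_td i p < m.+1) grid &&
    uniq [seq (p.1, difference_td i p) | p <- grid] &&
    all (fun j => (i != j) ==>
      uniq [seq (difference_td i p, difference_td j p) | p <- grid]) (iota 0 4))
  (iota 0 4).

Lemma has_td5_check : td5_check -> has_td5 'I_m.+1.
Proof.
move=> /allP chk.
have mio k a : (a \in iota 0 k) = (a < k) by rewrite mem_iota.
have i4 (i : 'I_4) : nat_of_ord i \in iota 0 4 by rewrite mio.
have gr (x y : 'I_m.+1) : (val x, val y) \in grid.
  by apply/allpairsP; exists (val x, val y); rewrite !mio /= !ltn_ord.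
pose t (i : 'I_4) (x y : 'I_m.+1) : 'I_m.+1 := inord (difference_td i (val x, val y)).
have tE i x y : t i x y = difference_td i (val x, val y) :> nat.
  rewrite inordK //; have /chk /andP[/andP[/allP h _] _] := i4 i.
  exact: h.
exists t; split.
  move=> i x y y' /(congr1 val) /=; rewrite !tE => E.
  have /chk /andP[/andP[_ u] _] := i4 i.
  have [/val_inj //] := uniq_map_inj u (gr x y) (gr x y') (congr1 (pair (val x)) E).
move=> i j ij [x y] [x' y'] /= [/(congr1 val) /= E1 /(congr1 val) /= E2].
rewrite !tE in E1 E2.
have /chk /andP[_ /allP /(_ _ (i4 j)) /implyP /(_ ij) u] := i4 i.
have [/val_inj-> /val_inj->] := uniq_map_inj u (gr x y) (gr x' y') (congr2 pair E1 E2).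
by [].
Qed.

End TransversalCheck.

(** The rows are the multiples of F_4 by 0, 1, w and w^2. *)
Lemma has_td5_4 : has_td5 'I_4.
Proof.
apply: (@has_td5_check 3 [:: 2; 2]
  [:: nseq 4 0; iota 0 4; [:: 0; 2; 3; 1]; [:: 0; 3; 1; 2]]).
by vm_cast_no_check (erefl true).
Qed.

Lemma has_td5_8 : has_td5 'I_8.
Proof.
apply: (@has_td5_check 7 [:: 2; 2; 2]
  [:: nseq 8 0; iota 0 8; [:: 0; 7; 5; 2; 6; 1; 3; 4]; [:: 0; 3; 7; 4; 5; 6; 2; 1]]).
by vm_cast_no_check (erefl true).
Qed.

Lemma has_td5_9 : has_td5 'I_9.
Proof.
apply: (@has_td5_check 8 [:: 3; 3]
  [:: nseq 9 0; iota 0 9; [:: 0; 3; 6; 5; 7; 2; 1; 8; 4]; [:: 0; 8; 3; 6; 5; 1; 2; 4; 7]]).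
by vm_cast_no_check (erefl true).
Qed.

Lemma has_td5_12 : has_td5 'I_12.
Proof.
apply: (@has_td5_check 11 [:: 2; 2; 3]
  [:: nseq 12 0; iota 0 12; [:: 0; 9; 8; 1; 10; 4; 5; 11; 3; 6; 7; 2];
      [:: 0; 8; 10; 2; 7; 11; 9; 5; 6; 1; 3; 4]]).
by vm_cast_no_check (erefl true).
Qed.

Lemma has_td5_20 : has_td5 'I_20.
Proof.
apply: (@has_td5_card ('I_4 * 'I_5)%type); first by rewrite card_prod !card_ord.
by apply: has_td5_prod; [apply: has_td5_4 | apply: has_td5_coprime6].
Qed.

(* The last group of the transversal design is truncated to [t] points, every
   point is tripled, and one point is added at infinity: blocks of size four and
   five become group divisible designs of type 3^4 and 3^5, and each group with
   the point at infinity becomes a smaller Steiner system. *)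
Section TruncatedTD.

Variables (m t : nat) (td : 'I_4 -> 'I_m -> 'I_m -> 'I_m).
Hypothesis t_le_m : t <= m.
Hypothesis td_inj : forall i x, injective (td i x).
Hypothesis td_inj2 : forall i j, i != j ->
  injective (fun p : 'I_m * 'I_m => (td i p.1 p.2, td j p.1 p.2)).

Definition td_point : finType := ('I_4 * 'I_m + 'I_t)%type.

Definition group_of (p : td_point) : option 'I_4 := if p is inl u then Some u.1 else None.

Definition on_block (xy : 'I_m * 'I_m) (p : td_point) : bool :=
  match p with
  | inl u => td u.1 xy.1 xy.2 == u.2
  | inr z => nat_of_ord z == xy.1
  end.

Lemma two_points_on_block p p' : group_of p != group_of p' ->
  exists2 xy, on_block xy p & on_block xy p'.
Proof.
have bij2 i j : i != j -> forall u v, exists xy : 'I_m * 'I_m,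
    td i xy.1 xy.2 = u /\ td j xy.1 xy.2 = v.
  move=> ij u v; have [g _ gK] := injF_bij (td_inj2 ij).
  by exists (g (u, v)); case: (gK (u, v)) => -> ->.
have bij1 i x : forall u, exists y, td i x y = u.
  by move=> u; have [g _ gK] := injF_bij (@td_inj i x); exists (g u).
case: p p' => [[i u]|z] [[j v]|z'] //= ij.
- by have [xy [<- <-]] := bij2 i j ij u v; exists xy => /=.
- have [y E] := bij1 i (widen_ord t_le_m z') u.
  by exists (widen_ord t_le_m z', y); rewrite /= ?E.
- have [y E] := bij1 j (widen_ord t_le_m z) v.
  by exists (widen_ord t_le_m z, y); rewrite /= ?E.
Qed.

Lemma one_block_on_points p p' xy xy' : group_of p != group_of p' ->
  on_block xy p -> on_block xy p' -> on_block xy' p -> on_block xy' p' -> xy = xy'.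
Proof.
case: xy xy' => [x y] [x' y'].
case: p p' => [[i u]|z] [[j v]|z'] //= ij /eqP E1 /eqP E2 /eqP E3 /eqP E4.
- by apply: (td_inj2 ij); rewrite /= E1 E2 E3 E4.
- have xx : x = x' by apply: val_inj; rewrite /= -E2 -E4.
  by subst x'; rewrite (td_inj (etrans E1 (esym E3))).
- have xx : x = x' by apply: val_inj; rewrite /= -E1 -E3.
  by subst x'; rewrite (td_inj (etrans E2 (esym E4))).
Qed.

Definition blown_up : finType := option ('I_3 * td_point).

Definition in_group (g : option 'I_4) (a : blown_up) : bool :=
  if a is Some u then group_of u.2 == g else true.

(** Each pair lies in one piece: pairs within a group or involving infinity belong to [inl], pairs
    across groups to the [inr] piece of the unique block joining them. Copies of one point share its
    group. *)
Definition piece (p : option 'I_4 + 'I_m * 'I_m) (a b : blown_up) : bool :=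
  match p with
  | inl g => [&& a != b, in_group g a & in_group g b]
  | inr xy => if (a, b) is (Some u, Some v) then
      [&& on_block xy u.2, on_block xy v.2 & group_of u.2 != group_of v.2] else false
  end.

Lemma steiner4_truncated_td :
  steiner4 (3 * m).+1 -> steiner4 (3 * t).+1 -> steiner4 (3 * (4 * m + t)).+1.
Proof.
move=> Sm St.
apply/(@steiner4P blown_up).
  by rewrite card_option card_prod card_sum card_prod !card_ord.
apply: (@k4_decomposable_union _ _ piece).
- by move=> a; rewrite /neq_rel eqxx.
- move=> a b; split=> [ab|[[g|xy]]]; last 2 first.
  + by case/and3P.
  + case: a b => [[l p]|] [[l' p']|] //= /and3P[_ _ gpp'].
    by apply: contraNneq gpp' => -[_ ->].
  case: a b ab => [[l p]|] [[l' p']|] //; rewrite /neq_rel => ab.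
  + have [E|gpp'] := eqVneq (group_of p) (group_of p').
      by exists (inl (group_of p)); rewrite /= E ab eqxx.
    have [xy h h'] := two_points_on_block gpp'.
    by exists (inr xy); rewrite /= h h'.
  + by exists (inl (group_of p)); rewrite /= eqxx.
  + by exists (inl (group_of p')); rewrite /= eqxx.
- move=> [g|xy] [g'|xy'] [[l p]|] [[l' p']|] //=.
  + by move=> /and3P[_ /eqP-> _] /and3P[_ /eqP-> _].
  + by move=> /andP[/eqP-> _] /andP[/eqP-> _].
  + by move=> /eqP-> /eqP->.
  + by move=> /and3P[_ /eqP-> /eqP->] /and3P[_ _]; rewrite eqxx.
  + by move=> /and3P[_ _ ne] /and3P[_ /eqP E1 /eqP E2]; rewrite E1 E2 eqxx in ne.
  + move=> /and3P[a1 a2 ne] /and3P[a3 a4 _].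
    by rewrite (one_block_on_points ne a1 a2 a3 a4).
move=> [[i|]|[x y]].
- pose f (a : option ('I_3 * 'I_m)) : blown_up :=
    if a is Some u then Some (u.1, inl (i, u.2)) else None.
  have f_inj : injective f by move=> [[l u]|] [[l' u']|] //= [-> ->].
  have fg a : in_group (Some i) (f a) by case: a => [[l u]|] //=.
  apply: (@k4_decomposable_image _ _ f (@neq_rel _)) => //.
  + by move=> a b; rewrite /neq_rel /= (inj_eq f_inj) !fg => ->.
  + have fo a : in_group (Some i) a -> exists a', f a' = a.
      case: a => [[l [[i' u]|z]]|] //=; last by exists None.
      by move=> /eqP[->]; exists (Some (l, u)).
    move=> a b /and3P[ab /fo[a' aE] /fo[b' bE]]; subst a b.
    by exists a', b'; split=> //; rewrite /neq_rel -(inj_eq f_inj).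
  by apply/(@steiner4P _ (3 * m).+1) => //; rewrite card_option card_prod !card_ord.
- pose f (a : option ('I_3 * 'I_t)) : blown_up :=
    if a is Some u then Some (u.1, inr u.2) else None.
  have f_inj : injective f by move=> [[l u]|] [[l' u']|] //= [-> ->].
  have fg a : in_group None (f a) by case: a => [[l u]|] //=.
  apply: (@k4_decomposable_image _ _ f (@neq_rel _)) => //.
  + by move=> a b; rewrite /neq_rel /= (inj_eq f_inj) !fg => ->.
  + have fo a : in_group None a -> exists a', f a' = a.
      case: a => [[l [[i' u]|z]]|] //=; last by exists None.
      by exists (Some (l, z)).
    move=> a b /and3P[ab /fo[a' aE] /fo[b' bE]]; subst a b.
    by exists a', b'; split=> //; rewrite /neq_rel -(inj_eq f_inj).
  by apply/(@steiner4P _ (3 * t).+1) => //; rewrite card_option card_prod !card_ord.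
(* The block of [(x, y)] meets the truncated group exactly when [x < t]; it has five points then,
   and four otherwise. *)
have [xt|tx] := ltnP x t.
- pose pt (k : option 'I_4) : td_point :=
    if k is Some i then inl (i, td i x y) else inr (Ordinal xt).
  have ptg k : group_of (pt k) = k by case: k.
  have pton k : on_block (x, y) (pt k) by case: k => /=.
  have ptE p : on_block (x, y) p -> pt (group_of p) = p.
    by case: p => [[i u]|z] /= /eqP E; rewrite ?E //; congr inr; apply: val_inj.
  pose f (a : 'I_3 * option 'I_4) : blown_up := Some (a.1, pt a.2).
  apply: (@k4_decomposable_image _ _ f (fun a b => a.2 != b.2)).
  + by move=> [l k] [l' k'] /= [-> /(congr1 group_of)]; rewrite !ptg => ->.
  + by move=> [l k] [l' k'] /= kk; rewrite !pton !ptg.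
  + case=> [[l p]|] [[l' p']|] //= /and3P[h h' ne].
    by exists (l, group_of p), (l', group_of p'); rewrite /f /= !ptE.
  by apply: gdd3_5; rewrite card_option card_ord.
pose f (a : 'I_3 * 'I_4) : blown_up := Some (a.1, inl (a.2, td a.2 x y)).
apply: (@k4_decomposable_image _ _ f (fun a b => a.2 != b.2)).
- by move=> [l k] [l' k'] /= [-> ->].
- by move=> [l k] [l' k'] /= kk; rewrite !eqxx.
- have fo p : on_block (x, y) p -> exists2 k, group_of p = Some k & p = inl (k, td k x y).
    case: p => [[i u]|z] /= /eqP E; first by exists i => //; rewrite E.
    by have := ltn_ord z; rewrite E ltnNge tx.
  case=> [[l p]|] [[l' p']|] //= /and3P[/fo[k -> ->] /fo[k' -> ->] ne].
  by exists (l, k), (l', k').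
by apply: gdd3_4; rewrite card_ord.
Qed.

End TruncatedTD.

(** * Existence of the systems S(2,4,3r+1) *)

Lemma steiner4_td_step m t : has_td5 'I_m -> t <= m ->
  steiner4 (3 * m).+1 -> steiner4 (3 * t).+1 -> steiner4 (3 * (4 * m + t)).+1.
Proof. by case=> td [h1 h2] tm; apply: (@steiner4_truncated_td m t td). Qed.

Lemma steiner4_exists r : r %% 4 <= 1 -> steiner4 (3 * r).+1.
Proof.
elim/ltn_ind: r => r IH r4.
have step m : has_td5 'I_m -> m %% 4 <= 1 -> 0 < m -> 4 * m <= r <= 5 * m ->
    steiner4 (3 * r).+1.
  (* The truncation size [r - 4 * m] is congruent to [r] modulo 4 and at most [m < r], so induction
     applies to it and to [m]. *)
  move=> td m4 m0 /andP[le ge]; have -> : r = 4 * m + (r - 4 * m) by lia.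
  by apply: steiner4_td_step td _ _ _; [lia | apply: IH; lia..].
(* For r >= 240 the interval [r/5, r/4] contains an integer congruent to 1 mod 12. *)
have [big|small] := leqP 240 r.
  pose m := 12 * ((r %/ 4 - 1) %/ 12) + 1.
  apply: (step m); rewrite /m; try lia.
  apply: has_td5_coprime6; rewrite /coprime -gcdn_modl.
  by have -> : (12 * ((r %/ 4 - 1) %/ 12) + 1) %% 6 = 1 by lia.
have tds m : m \in [:: 4; 5; 8; 9; 12; 13; 17; 20; 25; 29; 37; 41; 49] -> has_td5 'I_m.
  rewrite !inE => h; repeat (case/orP: h => [/eqP->|h]); last move/eqP: h => ->.
  all: try by [apply: has_td5_coprime6].
  - exact: has_td5_4.
  - exact: has_td5_8.
  - exact: has_td5_9.
  - exact: has_td5_12.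
  - exact: has_td5_20.
(* These are the admissible values below 240 that no [m] in [ms] reaches. *)
pose direct := [:: 0; 1; 4; 5; 8; 9; 12; 13; 28; 29].
pose ms := [:: 4; 5; 8; 9; 12; 13; 17; 20; 25; 29; 37; 41; 49].
have : all (fun r => (r %% 4 <= 1) ==>
    (r \in direct) ||
    has (fun m => [&& m %% 4 <= 1, 0 < m & 4 * m <= r <= 5 * m]) ms) (iota 0 240).
  by vm_compute.
move=> /allP /(_ r); rewrite mem_iota => /(_ small) /implyP /(_ r4) /orP[].
  rewrite !inE => h; repeat (case/orP: h => [/eqP->|h]); last move/eqP: h => ->.
  - exact: steiner4_1.
  - exact: steiner4_4.
  - exact: steiner4_13.
  - exact: steiner4_16.
  - exact: steiner4_25.
  - exact: steiner4_28.
  - exact: steiner4_37.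
  - exact: steiner4_40.
  - exact: steiner4_85.
  - exact: steiner4_88.
by move=> /hasP[m /tds td /and3P[m4 m0 mr]]; apply: (step m).
Qed.

(** * Assembly *)

Section Assembly.

Variables (U : finType) (u0 : U) (D : {set {ffun 'I_4 -> U}}).
Hypothesis D_neq : forall b i j, b \in D -> i != j -> b i != b j.
Hypothesis D_cover : forall x y, x != y -> exists b i j, [/\ b \in D, b i = x & b j = y].
Hypothesis D_uniq : forall b b' i j i' j', b \in D -> b' \in D -> i != j ->
  b i = b' i' -> b j = b' j' -> b = b'.

Definition point : finType := option (U * 'I_32).

(** Class [(x, i)] joins class [i] of the KTS(33) on group [x] and infinity to the frame classes
    with index [i] that miss [x], over all blocks through [x]. The value [(u0, ord0)] is a dummy. *)
Definition joint (a b : point) : U * 'I_16 :=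
  match a, b with
  | None, None => (u0, ord0)
  | None, Some (y, t) => (y, q33 None (Some t))
  | Some (x, s), None => (x, q33 (Some s) None)
  | Some (x, s), Some (y, t) =>
    if x == y then (x, q33 (Some s) (Some t)) else
    if [pick w : {ffun 'I_4 -> U} * ('I_4 * 'I_4)
        | [&& w.1 \in D, w.1 w.2.1 == x & w.1 w.2.2 == y]] is Some (b, (i, j))
    then let r := frame (i, s) (j, t) in (b r.1, r.2) else (u0, ord0)
  end.

Lemma D_inj b : b \in D -> injective b.
Proof. by move=> bD i j E; apply/eqP/(contraTT (D_neq bD (j := j))); rewrite E eqxx. Qed.

(** Two points lie in one block, with one labelling, so the choice made by [pick] is forced. *)
Lemma joint_cross b i j s t : b \in D -> i != j ->
  joint (Some (b i, s)) (Some (b j, t)) =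
  (b (frame (i, s) (j, t)).1, (frame (i, s) (j, t)).2).
Proof.
move=> bD ij /=; rewrite (negbTE (D_neq bD ij)).
case: pickP => [[b' [i' j']] /= /and3P[b'D /eqP Ei /eqP Ej] | /(_ (b, (i, j)))]; last first.
  by rewrite /= bD !eqxx.
have E := D_uniq bD b'D ij (esym Ei) (esym Ej); subst b'.
by rewrite (D_inj bD Ei) (D_inj bD Ej).
Qed.

Lemma joint_crossP x y s t : x != y -> exists b i j,
  [/\ [/\ b \in D, b i = x, b j = y & i != j],
      joint (Some (x, s)) (Some (y, t)) =
      (b (frame (i, s) (j, t)).1, (frame (i, s) (j, t)).2),
      b (frame (i, s) (j, t)).1 != x & b (frame (i, s) (j, t)).1 != y].
Proof.
move=> xy; have [b [i [j [bD Ei Ej]]]] := D_cover xy; subst x y.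
have ij : i != j by apply: contraNneq xy => ->.
exists b, i, j; rewrite joint_cross //.
have [_ /andP[/= h h']] := @enc_frame (i, s) (j, t) ij.
by split=> //; apply: D_neq => //; rewrite eq_sym.
Qed.

Lemma jointC a b : joint a b = joint b a.
Proof.
have [q33C _] := q33_edge_colouring.
case: a b => [[x s]|] [[y t]|]; [|by rewrite /= q33C|by rewrite /= q33C|by []].
have [->|xy] := eqVneq x y; first by rewrite /= eqxx q33C.
have [b [i [j [[bD Ei Ej ij] -> _ _]]]] := joint_crossP s t xy; subst x y.
by rewrite joint_cross // 1?eq_sym // frameC.
Qed.

Definition embed (x : U) (o : option 'I_32) : point :=
  if o is Some s then Some (x, s) else None.

Lemma embed_inj x : injective (embed x).
Proof. by move=> [s|] [t|] //= [->]. Qed.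

Lemma joint_embed x o o' : o != o' -> joint (embed x o) (embed x o') = (x, q33 o o').
Proof. by case: o o' => [s|] [t|] //= _; rewrite eqxx. Qed.

Definition point_colour (a : point) : 'I_4 := if a is Some p then c32 p.2 else c33 None.

Lemma point_colour_embed x o : point_colour (embed x o) = c33 o.
Proof. by case: o. Qed.

Lemma joint_spec a j : exists y z,
  [/\ uniq [:: a; y; z], joint a y = j, joint a z = j,
      joint y z = j /\ ~~ ((point_colour a == point_colour y)
                        && (point_colour a == point_colour z))
    & forall w, w != a -> joint a w = j -> w = y \/ w = z].
Proof.
case: j => x i.
have inner o : exists y z,
  [/\ uniq [:: embed x o; y; z],
      joint (embed x o) y = (x, i), joint (embed x o) z = (x, i),
      joint y z = (x, i) /\ ~~ ((point_colour (embed x o) == point_colour y)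
                              && (point_colour (embed x o) == point_colour z))
    & forall w, w != embed x o -> joint (embed x o) w = (x, i) -> w = y \/ w = z].
  have [y [z [un qy qz [qyz nm] only]]] := q33_spec o i.
  have [[oy oz] yz] : (o != y /\ o != z) /\ y != z.
    by move: un; rewrite /= !inE negb_or => /and3P[/andP[]].
  exists (embed x y), (embed x z); split.
  - by rewrite -(map_inj_uniq (@embed_inj x)) in un.
  - by rewrite joint_embed ?qy.
  - by rewrite joint_embed ?qz.
  - by rewrite joint_embed ?qyz // !point_colour_embed.
  move=> w wo jw.
  (* An edge from group [x] to another group has a class indexed by a third point of [U], so [w]
     stays in group [x] or is infinity. *)
  have [o' E] : exists o', w = embed x o'.
    case: w wo jw => [[y' t]|] wo; last by exists None.
    case: o {un qy qz nm only oy oz} wo => [s|] wo; last first.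
      by case=> -> _; exists (Some t).
    have [->|xy] := eqVneq x y'; first by exists (Some t).
    have [b [k [l [_ -> h _]]]] := joint_crossP s t xy.
    by case=> E _; rewrite E eqxx in h.
  subst w; have oo' : o' != o by rewrite -(inj_eq (@embed_inj x)).
  move: jw; rewrite joint_embed 1?eq_sym // => -[] /(only _ oo') [] ->; by [left | right].
case: a => [[x' s]|]; last exact: (inner None).
have [->|xx'] := eqVneq x' x; first exact: (inner (Some s)).
(* Outside group [x], the triple comes from the frame on the block through [x'] and [x]. *)
have [b [ia [ic [bD Ea Ec]]]] := D_cover xx'; subst x' x.
have ac : ia != ic by apply: contraNneq xx' => ->.
have [[k t] [[l r] [[ak al kl] [qk ql qkl] nm only]]] := @frame_spec (ia, s) (ic, i) ac.
rewrite /= in ak al kl.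
exists (Some (b k, t)), (Some (b l, r)); split.
- rewrite /= !inE negb_or andbT.
  have ne k1 k2 t1 t2 : k1 != k2 -> Some (b k1, t1) != Some (b k2, t2) :> point.
    by move=> kk; apply/eqP => -[] /(D_inj bD) E; rewrite E eqxx in kk.
  by rewrite !ne.
- by rewrite (joint_cross s t bD ak) qk.
- by rewrite (joint_cross s r bD al) ql.
- by rewrite (joint_cross t r bD kl) qkl.
case=> [[y v]|] wa; last by case=> E; rewrite E eqxx in xx'.
have [E|xy] := eqVneq (b ia) y.
  by rewrite /= E eqxx => -[E' _]; rewrite E E' eqxx in xx'.
have [b' [i' [j' [[b'D Ei' Ej' ij'] -> h _]]]] := joint_crossP s v xy.
set f := frame _ _ in h * => /eqP; rewrite xpair_eqE => /andP[/eqP E1 /eqP E2].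
have i'f : i' != f.1 by apply: contraNneq h => <-; rewrite Ei'.
(* The block used by the edge to [w] also contains both the group of the point and the missed group,
   hence is [b]. *)
have Eb : b' = b := D_uniq b'D bD i'f Ei' E1.
subst b'; move: (D_inj bD Ei') => E; subst i' y.
have : frame (ia, s) (j', v) = (ic, i).
  by rewrite -/f [f]surjective_pairing E2 (D_inj bD E1).
by move/only => /(_ ij') [] [-> ->]; [left | right].
Qed.

Lemma joint_edge_colouring : triangle_edge_colouring joint.
Proof.
split=> [x y|x j]; first exact: jointC.
by have [y [z [h1 h2 h3 [h4 _] h5]]] := joint_spec x j; exists y, z.
Qed.

Lemma point_colour_proper : proper_on_triangles joint point_colour.
Proof.
apply: proper_of_spec => x j.
by have [y [z [h1 h2 h3 [_ h4] h5]]] := joint_spec x j; exists y, z.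
Qed.

(** Group [u0] with infinity carries a copy of the KTS(33), to which any colouring restricts. *)
Lemma joint_not_3_colourable d (c : point -> 'I_d) :
  proper_on_triangles joint c -> 3 < d.
Proof.
move=> cP; rewrite ltnNge; apply/negP => d3.
apply: (@q33_not_3_colourable (fun o => c (embed u0 o))).
  by move=> o; apply: leq_trans d3.
move=> x y z un qy qz /val_inj cy /val_inj cz.
have [[xy xz] yz] : (x != y /\ x != z) /\ y != z.
  by move: un; rewrite /= !inE negb_or => /and3P[/andP[]].
apply: (cP _ _ _ _ _ _ cy cz); rewrite ?joint_embed ?qy ?qz //.
by rewrite -(map_inj_uniq (@embed_inj u0)) in un.
Qed.

Lemma card_c32 i : #|[set s | c32 s == i]| = 8.
Proof.
have -> : #|[set s | c32 s == i]|
        = count (fun s => col32 s == i) [seq val s | s <- enum 'I_32].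
  rewrite count_map -sum1_count big_enum_cond -sum1dep_card; apply: eq_bigl => s.
  by rewrite -(inj_eq val_inj) /= inordK ?ltn_mod.
rewrite val_enum_ord.
by case: i => -[|[|[|[|]]]].
Qed.

(** Every group contributes eight points to each colour, and infinity adds one point to a single
    colour. *)
Lemma point_colour_equitable : equitable point_colour.
Proof.
suff E i : #|colour_class point_colour i| = (c33 None == i) + #|U| * 8.
  by move=> i j; rewrite !E; do 2!case: (_ == _); lia.
have -> : colour_class point_colour i =
    [set a | (a == None) && (c33 None == i)]
    :|: Some @: setX [set: U] [set s | c32 s == i].
  apply/setP => -[[x s]|]; rewrite !inE /=.
    apply/idP/imsetP => [h|[[x' s'] h [_ ->]]]; last by move: h; rewrite !inE.
    by exists (x, s); rewrite ?inE.
  by apply/idP/orP => [->|[//|/imsetP[? _]//]]; left.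
rewrite cardsU disjoint_setI0 ?cards0 ?subn0; last first.
  apply/pred0P => -[p|]; rewrite /= !inE //; apply/negP => /andP[_ /imsetP[? _]] //.
rewrite card_imset; last by move=> ? ? [].
rewrite cardsX cardsT card_c32; congr addn.
case: (_ == _).
  by apply: etrans (cards1 (None : point)); apply: eq_card => a; rewrite !inE andbT.
by apply: eq_card0 => a; rewrite !inE andbF.
Qed.

End Assembly.

Unset Implicit Arguments.

Theorem theorem4p5 (u : nat) (u_gt0 : 0 < u)
    (u_mod : u = 1 %[mod 12] \/ u = 4 %[mod 12]) :
  exists (T : finType) (B : {set {set T}}) (P : {set {set {set T}}}),
    [/\ #|T| = 32 * u + 1,
        kirkman_triple_system B P,
        chromatic_number_is B 4
      & exists c : T -> 'I_4, colouring B c /\ equitable c].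
Proof.
(* The residues 1 and 4 modulo 12 of [u = 3r + 1] correspond to 0 and 1 modulo 4 for [r]. *)
have uE : u = (3 * (u %/ 3)).+1 by lia.
have [D [D1 D2 D3]] : steiner4 u by rewrite uE; apply: steiner4_exists; lia.
pose u0 := Ordinal u_gt0.
have jP := joint_edge_colouring u0 D1 D2 D3.
have cP : colouring (triangles (joint u0 D)) (@point_colour _).
  by apply/(colouring_trianglesP jP)/point_colour_proper.
exists (point 'I_u), (triangles (joint u0 D)), (edge_classes (joint u0 D)); split.
- by rewrite card_option card_prod !card_ord mulnC addn1.
- exact: triangle_edge_colouring_kts jP None.
- split; first by exists (@point_colour _).
  by move=> d [c /(colouring_trianglesP jP) /joint_not_3_colourable].
- by exists (@point_colour _); split=> //; apply: point_colour_equitable.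
Qed.
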